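(* Let $p\in(0,1]$ and let $M_1,M_2$ be functions on $[0,1]$ such that $t\mapsto M_1(t^{1/p})$ and $t\mapsto M_2(t^{1/p})$ are Orlicz functions, with fundamental functions $\varphi_{M_1},\varphi_{M_2}$. Let $k,n\in\mathbb{N}$ and let $id:\ell_{M_1}^n\to\ell_{M_2}^n$ be the natural embedding (the identity map). Then $$e_k(id:\ell_{M_1}^n\to\ell_{M_2}^n)\ \ge\ \begin{cases}2^{-1/p}&\text{if }1\le k<\log(2n),\\[2mm] c(p)\,\dfrac{\varphi_{M_2}\left(k/\log(2n/k)\right)}{\varphi_{M_1}\left(k/\log(2n/k)\right)}&\text{if }\log(2n)\le k\le n,\end{cases}$$ where $$c(p)=4^{-2}\,2^{-19/p}\left(\log\tfrac{24}{p}\right)^{-2/p}\left(\tfrac1p\right)^{-1/p}.$$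
   Context: All spaces are real; $\log=\log_2$; $\mathbb{N}=\{1,2,\dots\}$. Orlicz function: a continuous, strictly increasing, convex function $N:[0,1]\to\mathbb{R}$ with $N(0)=0$, $N(1)=1$. For $M$ on $[0,1]$ such that $t\mapsto M(t^{1/p})$ is an Orlicz function for some $p\in(0,1]$, $\ell_M^n$ denotes $\mathbb{R}^n$ with the $p$-norm $\|x\|_{\ell_M}=\inf\{\varrho>0:\ \sum_{i=1}^n M(|x_i|/\varrho)\le 1\}$. Convention: $M(t)=+\infty$ for $t>1$, so only $\varrho$ with $|x_i|\le\varrho$ for all $i$ are admissible. Fundamental function: $\varphi_M(t)=1/M^{-1}(1/t)$ for $t\ge1$. Entropy numbers: for a continuous linear map $T:X\to Y$ between quasi-Banach spaces with closed unit balls $B_X,B_Y$, $e_k(T)=\inf\{\varepsilon>0:\ T(B_X)\subset\bigcup_{i=1}^{2^{k-1}}(y_i+\varepsilon B_Y)\text{ for some }y_1,\dots,y_{2^{k-1}}\in Y\}$. *)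

(* Defs.v *)
From HB Require Import structures.
From mathcomp Require Import all_boot all_order all_algebra.
From mathcomp Require Import all_classical all_reals all_analysis.

Set Implicit Arguments.
Unset Strict Implicit.
Unset Printing Implicit Defensive.

Import Order.TTheory GRing.Theory Num.Theory.
Import numFieldNormedType.Exports.

Local Open Scope classical_set_scope.
Local Open Scope ring_scope.

Definition log2 (R : realType) (x : R) : R := ln x / ln 2.

(* Functions on [0,1] are represented by total functions R -> R; nothing below
   depends on their values outside [0,1]. *)
Definition orlicz_function (R : realType) (N : R -> R) : Prop :=
  [/\ {within `[0, 1], continuous N},
      {in `[0, 1] &, {homo N : s t / s < t}},
      @convex_function R R^o `[0, 1] N,
      N 0 = 0 & N 1 = 1].

(* The constraint |x_i| <= rho encodes the convention M(t) = +oo for t > 1. *)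
Definition lM_norm (R : realType) (M : R -> R) (n : nat) (x : 'rV[R]_n) : R :=
  inf [set rho : R | [/\ 0 < rho, (forall i, `|x ord0 i| <= rho) &
                         \sum_(i < n) M (`|x ord0 i| / rho) <= 1]].

Definition fundamental_function (R : realType) (M : R -> R) (t : R) : R :=
  (pinv (`[0, 1] : set R) M t^-1)^-1.

Definition unit_ball (R : realType) (X : Type) (q : X -> R) : set X :=
  [set x | q x <= 1].

(* The k-th entropy number (k >= 1) of T : (X, qX) -> (Y, qY), where qX and qY
   are the quasi-norms of X and Y. *)
Definition entropy_number (R : realType) (X Y : lmodType R)
    (qX : X -> R) (qY : Y -> R) (T : {linear X -> Y}) (k : nat) : R :=
  inf [set eps : R | 0 < eps /\
    exists y : 'I_(2 ^ k.-1) -> Y,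
      T @` unit_ball qX `<=`
        \bigcup_i [set y i + eps *: b | b in unit_ball qY]].

Definition entropy_const (R : realType) (p : R) : R :=
  4 ^- 2 * 2 `^ (- (19 / p)) * log2 (24 / p) `^ (- (2 / p))
    * (1 / p) `^ (- (1 / p)).

(* Main.v *)
(** For [k < log2 (2n)] two of the [n] unit vectors lie in the same covering
    ball, and they differ by [1] in some coordinate.

    For larger [k], cut the coordinates into [s ~ 2t] blocks ([s = n] if [2t]
    exceeds [n]) and put into each block a single entry, with value in
    [{1/64, ..., 64/64} * a], where [a = 3 `^ (-1/p) * M1^-1 (1/t)] keeps these
    vectors in the unit ball of [l_M1^n].  They are the words of length [s] over
    an alphabet of size [Q = 64 (n / s)], and a Hamming ball of radius [s/2] has
    at most [2^s Q^(s/2)] words, so that [2^(k-1)] such balls do not exhaust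
    the [Q^s] words.  Within each block at most one letter is [a/128]-close to
    the centre of a given covering ball; hence some word lies in a covering ball
    while being [a/128]-far from its centre in at least [t/2]
    coordinates.  The bound on [eps] follows, since [M2 (2 `^ (-1/p) u) <=
    M2 u / 2] by convexity. *)

Require Import Defs.
From HB Require Import structures.
From mathcomp Require Import all_boot all_order all_algebra.
From mathcomp Require Import all_classical all_reals all_analysis.
From mathcomp Require Import ring lra zify.

Import Order.TTheory GRing.Theory Num.Theory.
Import numFieldNormedType.Exports.

Local Open Scope classical_set_scope.
Local Open Scope ring_scope.

Set Implicit Arguments.
Unset Strict Implicit.
Unset Printing Implicit Defensive.

(** * Counting words in Hamming balls *)

(** Sort the words by the set [E] of positions where they differ from [w0]: there are at most
    [2 ^ #|I|] such sets, and each with [#|E| <= m] accounts for at most [#|T| ^ #|E|] words. *)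
Lemma card_hamming_ball (I T : finType) (w0 : {ffun I -> T}) (m : nat) :
  (0 < #|T|)%N ->
  (#|[pred w : {ffun I -> T} | #|[pred i | w i != w0 i]| <= m]|
     <= 2 ^ #|I| * #|T| ^ m)%N.
Proof.
move=> T0; rewrite -sum1_card.
pose D (w : {ffun I -> T}) := finset.finset (fun i => w i != w0 i).
have -> : (2 ^ #|I| = #|{: {set I}}|)%N.
  by rewrite -[RHS]finset.cardsT -powersetT card_powerset finset.cardsT.
rewrite (partition_big D xpredT)//= -sum_nat_const.
apply: leq_sum => E _.
have [Em|mE] := leqP #|E| m; last first.
  rewrite big_pred0// => w; apply/negP => /andP[wm /eqP DE].
  move: mE; rewrite ltnNge -DE (eq_card (B := [pred i | w i != w0 i])).
    by move/negP; apply.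
  by move=> i; rewrite /D finset.in_set.
pose F i := if i \in E then xpredT else pred1 (w0 i) : pred T.
apply: (@leq_trans #|(family F : pred {ffun I -> T})|).
  rewrite sum1_card; apply: subset_leq_card; apply/fintype.subsetP => w.
  rewrite inE => /andP[_ /eqP DE]; apply/familyP => i; rewrite /F -DE /D finset.in_set.
  by case: ifPn => //; rewrite negbK.
rewrite card_family foldrE big_map big_enum/=.
apply: (@leq_trans (#|T| ^ #|E|)%N); last by rewrite leq_pexp2l.
rewrite -prod_nat_const big_mkcond [X in (_ <= X)%N]big_mkcond/=.
apply: leq_prod => i _; rewrite /F; case: ifPn => _; first exact: max_card.
by rewrite card1.
Qed.

(** Otherwise the fibre of [f] over each [j] would lie in the Hamming ball of radius [m] about
    [c j], and these balls have too few words in total. *)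
Lemma exists_far_word (I T J : finType) (c : J -> {ffun I -> T})
    (f : {ffun I -> T} -> J) (m : nat) :
  (0 < #|T|)%N -> (#|J| * (2 ^ #|I| * #|T| ^ m) < #|T| ^ #|I|)%N ->
  exists w : {ffun I -> T}, (m < #|[pred i | w i != c (f w) i]|)%N.
Proof.
move=> T0 lt; apply/existsP; apply: contraLR lt; rewrite negb_exists -leqNgt.
move=> /forallP near; rewrite -card_ffun -sum1_card (partition_big f xpredT)//=.
rewrite -sum_nat_const; apply: leq_sum => j _; rewrite sum1_card.
apply: leq_trans (card_hamming_ball (c j) m T0); apply: subset_leq_card.
apply/fintype.subsetP => w; rewrite !inE => /eqP <-.
by have := near w; rewrite -leqNgt.
Qed.

Lemma powRK1 (R : realType) (p u : R) : 0 < p -> 0 <= u ->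
  (u `^ p) `^ (1 / p) = u.
Proof.
by move=> p0 u0; rewrite -powRrM mul1r mulfV ?gt_eqF// powRr1.
Qed.

Lemma powR_itv01 (R : realType) (u r : R) : 0 < r -> 0 <= u <= 1 ->
  0 <= u `^ r <= 1.
Proof.
move=> r0 /andP[u0 u1]; rewrite powR_ge0/=.
have -> : 1 = 1 `^ r :> R by rewrite powR1.
by apply: ge0_ler_powR; rewrite ?nnegrE ?(ltW r0).
Qed.

Lemma orlicz_at0 (R : realType) (p : R) (M : R -> R) : 0 < p ->
  orlicz_function (fun t => M (t `^ (1 / p))) -> M 0 = 0.
Proof.
by move=> p0 [_ _ _ + _]; rewrite powR0// mul1r invr_eq0 gt_eqF.
Qed.

Lemma orlicz_at1 (R : realType) (p : R) (M : R -> R) :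
  orlicz_function (fun t => M (t `^ (1 / p))) -> M 1 = 1.
Proof. by move=> [_ _ _ _]; rewrite powR1. Qed.

Lemma orlicz_lt (R : realType) (p : R) (M : R -> R) (u v : R) : 0 < p ->
  orlicz_function (fun t => M (t `^ (1 / p))) ->
  0 <= u -> u < v -> v <= 1 -> M u < M v.
Proof.
move=> p0 [_ + _ _ _] u0 uv v1.
have v0 : 0 <= v by rewrite (le_trans u0)// ltW.
move=> /(_ (u `^ p) (v `^ p)); rewrite !powRK1//; apply.
- by rewrite in_itv/= powR_itv01// u0 (le_trans _ v1)// ltW.
- by rewrite in_itv/= powR_itv01// v0.
- by apply: gt0_ltr_powR => //; rewrite nnegrE.
Qed.

Lemma orlicz_le (R : realType) (p : R) (M : R -> R) (u v : R) : 0 < p ->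
  orlicz_function (fun t => M (t `^ (1 / p))) ->
  0 <= u -> u <= v -> v <= 1 -> M u <= M v.
Proof.
move=> p0 MO u0; rewrite le_eqVlt => /predU1P[-> //|uv] v1.
by rewrite ltW// (orlicz_lt p0 MO).
Qed.

Lemma orlicz_ge0 (R : realType) (p : R) (M : R -> R) (u : R) : 0 < p ->
  orlicz_function (fun t => M (t `^ (1 / p))) ->
  0 <= u -> u <= 1 -> 0 <= M u.
Proof. by move=> p0 MO u0 u1; rewrite -(orlicz_at0 p0 MO) (orlicz_le p0 MO). Qed.

(** Convexity of [t |-> M (t]^ (1 / p))[on the segment from]0[, where it vanishes, to]u [^ p]. This
    inequality carries all later uses of convexity. *)
Lemma orlicz_scale (R : realType) (p : R) (M : R -> R) (c u : R) : 0 < p ->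
  orlicz_function (fun t => M (t `^ (1 / p))) ->
  0 <= c <= 1 -> 0 <= u <= 1 -> M (c `^ (1 / p) * u) <= c * M u.
Proof.
move=> p0 [_ _ Mconv M0 _] /andP[c0 c1] /andP[u0 u1].
have /andP[up0 up1] : 0 <= u `^ p <= 1 by rewrite powR_itv01// u0.
have ci : Itv.spec (@Itv.num_sem R) (Itv.Real `[0%Z, 1%Z]%R) c.
  by apply/and3P; split; rewrite //= ?bnd_simp ?num_real.
have := Mconv (Itv.mk ci) (u `^ p) 0.
rewrite !inE/= !in_itv/= up0 up1 lexx ler01 => /(_ isT isT).
move=> h; have {h} : M ((c * u `^ p + (1 - c) * 0) `^ (1 / p)) <=
    c * M ((u `^ p) `^ (1 / p)) + (1 - c) * M (0 `^ (1 / p)) := h.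
by rewrite M0 !mulr0 !addr0 powRM// powRK1.
Qed.

Lemma orlicz_surj (R : realType) (p : R) (M : R -> R) (y : R) : 0 < p ->
  orlicz_function (fun t => M (t `^ (1 / p))) ->
  0 <= y <= 1 -> exists2 u : R, 0 <= u <= 1 & M u = y.
Proof.
move=> p0 [Mcont _ _ M0 M1] y01.
have [|c] := IVT (v := y) ler01 Mcont.
  by rewrite M0 M1 min_l// max_r.
rewrite in_itv/= => c01 <-; exists (c `^ (1 / p)) => //.
by rewrite powR_itv01// divr_gt0.
Qed.

(** Strict monotonicity makes [M] injective on [[0, 1]], so [pinv] is a genuine left inverse
    there. *)
Lemma fundamental_functionE (R : realType) (p : R) (M : R -> R) (u : R) :
  0 < p -> orlicz_function (fun t => M (t `^ (1 / p))) ->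
  0 <= u <= 1 -> fundamental_function M (M u)^-1 = u^-1.
Proof.
move=> p0 MO u01; rewrite /fundamental_function invrK pinvKV//; last first.
  by rewrite inE/= in_itv.
move=> v w; rewrite !inE/= !in_itv/= => /andP[v0 v1] /andP[w0 w1] vw.
have [vltw|wltv|//] := ltgtP v w.
- by have := orlicz_lt p0 MO v0 vltw w1; rewrite vw ltxx.
- by have := orlicz_lt p0 MO w0 wltv v1; rewrite vw ltxx.
Qed.

(** * The unit ball of [l_M^n] *)

Lemma lM_norm_le1 (R : realType) (M : R -> R) (n : nat) (x : 'rV[R]_n) :
  (forall i, `|x ord0 i| <= 1) -> \sum_(i < n) M `|x ord0 i| <= 1 ->
  lM_norm M x <= 1.
Proof.
move=> x1 sx1; apply: ge_inf; first by exists 0 => rho /= [/ltW].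
by split=> //; under eq_bigr do rewrite divr1.
Qed.

(** The bound uses [n + 1] so that the same number stays a positive scaling factor even for
    [n = 0]. *)
Lemma sum_le1 (R : realType) (n : nat) (F : 'I_n -> R) :
  (forall i, F i <= n.+1%:R^-1) -> \sum_(i < n) F i <= 1.
Proof.
move=> Fn; apply: (@le_trans _ _ (\sum_(i < n) n.+1%:R^-1)); first exact: ler_sum.
rewrite sumr_const card_ord -[X in X *+ _]mul1r -mulrnAr -[_ *+ n]mulr_natl mul1r.
by rewrite ler_pdivrMr ?ltr0Sn// mul1r ler_nat.
Qed.

Lemma lM_norm_admissible (R : realType) (p : R) (M : R -> R) (n : nat)
    (x : 'rV[R]_n) : 0 < p -> orlicz_function (fun t => M (t `^ (1 / p))) ->
  [set rho : R | [/\ 0 < rho, (forall i, `|x ord0 i| <= rho) &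
                     \sum_(i < n) M (`|x ord0 i| / rho) <= 1]] !=set0.
Proof.
move=> p0 MO; pose c : R := n.+1%:R^-1; pose S := 1 + \sum_(i < n) `|x ord0 i|.
have c01 : 0 <= c <= 1 by rewrite invr_ge0 ler0n/= invf_le1 ?ltr0Sn// ler1n.
have c0 : 0 < c by rewrite invr_gt0 ltr0Sn.
have S1 : 1 <= S by rewrite lerDl sumr_ge0.
have S0 : 0 < S by rewrite (lt_le_trans _ S1).
have xS i : `|x ord0 i| / S <= 1.
  rewrite ler_pdivrMr// mul1r /S (bigD1 i)//= addrCA lerDl.
  by rewrite addr_ge0// sumr_ge0.
have cp0 : 0 < c `^ (1 / p) by rewrite powR_gt0.
have cp1 : c `^ (1 / p) <= 1.
  by have /andP[] := powR_itv01 (divr_gt0 ltr01 p0) c01.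
have rhoE i : `|x ord0 i| / (S / c `^ (1 / p)) = c `^ (1 / p) * (`|x ord0 i| / S).
  by rewrite invf_div mulrCA.
exists (S / c `^ (1 / p)); split; first by rewrite divr_gt0.
- move=> i; rewrite -[X in _ <= X]mul1r -ler_pdivrMr ?divr_gt0// rhoE.
  by rewrite mulr_ile1// ?divr_ge0// ltW.
- apply: sum_le1 => i; rewrite rhoE.
  apply: (le_trans (orlicz_scale p0 MO c01 _)); first by rewrite divr_ge0//= ltW.
  rewrite -[X in _ <= X]mulr1 ler_pM2l// -(orlicz_at1 MO).
  by rewrite (orlicz_le p0 MO)// divr_ge0// ltW.
Qed.

Lemma unit_ball_coord (R : realType) (p : R) (M : R -> R) (n : nat)
    (x : 'rV[R]_n) (i : 'I_n) :
  0 < p -> orlicz_function (fun t => M (t `^ (1 / p))) ->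
  lM_norm M x <= 1 -> `|x ord0 i| <= 1.
Proof.
move=> p0 MO; apply: le_trans; apply: lb_le_inf.
  exact: lM_norm_admissible p0 MO.
by move=> rho /= [].
Qed.

(** A Chebyshev-type count. The infimum need not be known to be attained, so an admissible [rho < 2]
    is taken, which turns [beta] into [beta / 2]. *)
Lemma unit_ball_card_large (R : realType) (p : R) (M : R -> R) (n m : nat)
    (x : 'rV[R]_n) (beta : R) :
  0 < p -> orlicz_function (fun t => M (t `^ (1 / p))) ->
  lM_norm M x <= 1 -> 0 <= beta <= 1 ->
  (m <= #|[pred i | (beta <= `|x ord0 i|)%R]|)%N -> m%:R * M (beta / 2) <= 1.
Proof.
move=> p0 MO x1 /andP[b0 b1] mle.
have [rho [rho0 xrho srho] rho2] : exists2 rho, [/\ 0 < rho,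
    (forall i, `|x ord0 i| <= rho) & \sum_(i < n) M (`|x ord0 i| / rho) <= 1]
    & rho < 2.
  apply: inf_lt; first exact: lM_norm_admissible p0 MO.
  by apply: le_lt_trans x1 _; rewrite ltr1n.
have xr0 i : 0 <= `|x ord0 i| / rho by rewrite divr_ge0// ltW.
have xr1 i : `|x ord0 i| / rho <= 1 by rewrite ler_pdivrMr// mul1r.
have Mb0 : 0 <= M (beta / 2) by apply: (orlicz_ge0 p0 MO); lra.
apply: (@le_trans _ _ (#|[pred i | beta <= `|x ord0 i|]|%:R * M (beta / 2))).
  by rewrite ler_wpM2r// ler_nat.
apply: le_trans srho; rewrite mulr_natl -sumr_const big_mkcond/=.
apply: ler_sum => i _; case: ifPn => [bi|_]; last exact: (orlicz_ge0 p0 MO).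
apply: (orlicz_le p0 MO) => //; first by rewrite divr_ge0.
by rewrite ler_pM// ?invr_ge0// lef_pV2 ?posrE// ltW.
Qed.

(** * Lower bounds for entropy numbers through coverings *)

Lemma entropy_number_ge (R : realType) (p : R) (M1 M2 : R -> R) (n k : nat)
    (c : R) :
  0 < p -> orlicz_function (fun t => M1 (t `^ (1 / p))) ->
  orlicz_function (fun t => M2 (t `^ (1 / p))) ->
  (forall (eps : R) (y : 'I_(2 ^ k.-1) -> 'rV[R]_n), 0 < eps ->
    (forall x, lM_norm M1 x <= 1 ->
       exists i b, lM_norm M2 b <= 1 /\ x = y i + eps *: b) ->
    c <= eps) ->
  c <= @entropy_number R 'rV[R]_n 'rV[R]_n
         (lM_norm M1 (n := n)) (lM_norm M2 (n := n)) idfun k.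
Proof.
move=> p0 M1O M2O H; apply: lb_le_inf; last first.
  move=> eps /= [eps0 [y cov]]; apply: (H eps y) => // x x1.
  have [|i _ [b b1 xE]] := cov x; first by exists x.
  by exists i, b.
(* Some radius must be admissible: with all centres at [0], radius [d]^ (- (1 /
   p))[works, since entries of]x[are at most]1[and shrinking by]d [^ (1 / p)] makes each summand at
   most [d]. *)
pose d : R := n.+1%:R^-1.
have d01 : 0 <= d <= 1 by rewrite invr_ge0 ler0n/= invf_le1 ?ltr0Sn// ler1n.
have dp0 : 0 < d `^ (1 / p) by rewrite powR_gt0// invr_gt0 ltr0Sn.
have dp1 : d `^ (1 / p) <= 1.
  by have /andP[] := powR_itv01 (divr_gt0 ltr01 p0) d01.
exists (d `^ (1 / p))^-1; split; first by rewrite invr_gt0.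
exists (fun=> 0) => _ [x x1 <-].
have xi i : `|x ord0 i| <= 1 by exact: (unit_ball_coord i p0 M1O x1).
exists (Ordinal (expn_gt0 2 k.-1)) => //=.
exists (d `^ (1 / p) *: x); last by rewrite scalerA mulVf ?gt_eqF// scale1r add0r.
have dx i : `|(d `^ (1 / p) *: x) ord0 i| = d `^ (1 / p) * `|x ord0 i|.
  by rewrite mxE normrM gtr0_norm.
apply: lM_norm_le1 => [i|]; first by rewrite dx mulr_ile1// ltW.
apply: sum_le1 => i; rewrite dx.
apply: (le_trans (orlicz_scale p0 M2O d01 _)); first by rewrite normr_ge0 xi.
rewrite -[X in _ <= X]mulr1 ler_wpM2l//; first by case/andP: d01.
by rewrite -(orlicz_at1 M2O) (orlicz_le p0 M2O).
Qed.

(** By pigeonhole two unit vectors share a centre; in coordinate [i] their difference gives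
    [1 = eps * (b_i - b'_i)], and entries of unit ball elements are at most [1] in modulus. *)
Lemma entropy_number_ge_half (R : realType) (p : R) (M1 M2 : R -> R)
    (n k : nat) :
  0 < p -> orlicz_function (fun t => M1 (t `^ (1 / p))) ->
  orlicz_function (fun t => M2 (t `^ (1 / p))) ->
  (2 ^ k.-1 < n)%N ->
  2^-1 <= @entropy_number R 'rV[R]_n 'rV[R]_n
         (lM_norm M1 (n := n)) (lM_norm M2 (n := n)) idfun k.
Proof.
move=> p0 M1O M2O kn; apply: (entropy_number_ge p0 M1O M2O) => eps y eps0 cov.
pose x (i : 'I_n) : 'rV[R]_n := delta_mx ord0 i.
have xE i j : `|x i ord0 j| = (j == i)%:R by rewrite mxE eqxx/= normr_nat.
have xball i : lM_norm M1 (x i) <= 1.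
  apply: lM_norm_le1 => [j|]; first by rewrite xE lern1 leq_b1.
  rewrite (bigD1 i)//= xE eqxx (orlicz_at1 M1O) big1 ?addr0// => j ji.
  by rewrite xE (negbTE ji) (orlicz_at0 p0 M1O).
have /choice[f fP] i := cov _ (xball i).
have [i [j [ij fij]]] : exists i j, i != j /\ f i = f j.
  have /injectivePn[i [j ij fij]] : ~~ injectiveb f.
    by apply/injectiveP => /leq_card; rewrite !card_ord leqNgt kn.
  by exists i, j.
have [[b [b1 bE]] [b' [b'1 b'E]]] := (fP i, fP j).
have /(congr1 (fun v : 'rV_n => v ord0 i)) : x i - x j = eps *: (b - b').
  by rewrite bE b'E fij scalerBr opprD addrACA subrr add0r.
rewrite !mxE !eqxx (negbTE ij) andbF subr0 => /= epsE.
have := unit_ball_coord i p0 M2O b1; have := unit_ball_coord i p0 M2O b'1.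
rewrite !ler_norml => /andP[? ?] /andP[? ?]; nra.
Qed.

(** * Encoding words as block vectors *)

(* A letter [(c, v)] occupies position [c] of a block of length [b], with value
   [(v + 1) / q]. *)
Definition letter_val (R : realType) (b q : nat) (l : 'I_b * 'I_q) (c : 'I_b)
    : R := if c == l.1 then l.2.+1%:R / q%:R else 0.

Lemma letter_val_itv (R : realType) (b q : nat) (l : 'I_b * 'I_q) (c : 'I_b) :
  0 <= letter_val R l c <= 1.
Proof.
have q0 : 0 < q%:R :> R by rewrite ltr0n (leq_trans _ (ltn_ord l.2)).
rewrite /letter_val; case: ifP => _; last by rewrite lexx ler01.
by rewrite divr_ge0//= ler_pdivrMr// mul1r ler_nat.
Qed.

(** At distinct positions one value faces [0], and the shift to [v + 1] keeps it at least [1 / q];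
    at a common position distinct values differ by a multiple of [1 / q]. *)
Lemma letter_val_sep (R : realType) (b q : nat) (l l' : 'I_b * 'I_q) :
  l != l' -> exists c, q%:R^-1 <= `|letter_val R l c - letter_val R l' c|.
Proof.
case: l l' => [c v] [c' v'].
have q0 : 0 < q%:R :> R by rewrite ltr0n (leq_trans _ (ltn_ord v)).
have [<-{c'}|cc' _] := eqVneq c c'; last first.
  exists c; rewrite /letter_val/= eqxx (negbTE cc') subr0 ger0_norm ?divr_ge0//.
  by rewrite ler_pdivlMr// mulVf ?gt_eqF// ler1n.
rewrite xpair_eqE eqxx/= => vv'.
exists c; rewrite /letter_val/= eqxx -mulrBl normrM normfV normr_nat.
rewrite -[X in X <= _]mul1r ler_pM2r ?invr_gt0//.
wlog vltv' : v v' vv' / (v < v')%N.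
  move=> wl; move: (vv'); rewrite -val_eqE neq_ltn => /orP[|] h; first exact: wl.
  by rewrite distrC wl// eq_sym.
rewrite distrC -natrB ?normr_nat ?ler1n ?subn_gt0//.
by rewrite ltnS ltnW.
Qed.

Section block_vector.
Context (R : realType) (n s b q : nat) (a : R) (g : 'I_s * 'I_b -> 'I_n).
Implicit Type w : {ffun 'I_s -> 'I_b * 'I_q}.

(** [g (i, c)] is the coordinate at position [c] of block [i]; coordinates outside the image of [g]
    are filled with [0]. *)
Definition block_vector w : 'rV[R]_n :=
  \row_j (if [pick ic | g ic == j] is Some ic
          then a * letter_val R (w ic.1) ic.2 else 0).

Hypothesis g_inj : injective g.

Lemma block_vectorE w ic :
  block_vector w ord0 (g ic) = a * letter_val R (w ic.1) ic.2.
Proof.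
rewrite mxE; case: pickP => [ic' /eqP/g_inj -> //|/(_ ic)].
by rewrite eqxx.
Qed.

Lemma block_vector_ball (p : R) (M : R -> R) w : 0 < p ->
  orlicz_function (fun t => M (t `^ (1 / p))) ->
  0 <= a <= 1 -> s%:R * M a <= 1 -> lM_norm M (block_vector w) <= 1.
Proof.
move=> p0 MO /andP[a0 a1] sMa.
have bv j : 0 <= block_vector w ord0 j <= a.
  rewrite mxE; case: pickP => [ic _|_]; last by rewrite lexx.
  have /andP[l0 l1] := letter_val_itv R (w ic.1) ic.2.
  by rewrite mulr_ge0//= ler_piMr.
have abv j : `|block_vector w ord0 j| = block_vector w ord0 j.
  by rewrite ger0_norm//; case/andP: (bv j).
apply: lM_norm_le1 => [j|].
  by rewrite abv (le_trans _ a1)//; case/andP: (bv j).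
apply: le_trans sMa; rewrite mulr_natl -[X in _ *+ X]card_ord -sumr_const.
have Ma0 := orlicz_ge0 p0 MO a0 a1.
(* Charge each nonzero coordinate to the block containing it; every block is charged once, at the
   position of its letter. *)
apply: (@le_trans _ _ (\sum_(j < n) \sum_(i < s)
    if g (i, (w i).1) == j then M a else 0)); last first.
  rewrite exchange_big/=; apply: ler_sum => i _.
  by rewrite -big_mkcond/= (big_pred1 (g (i, (w i).1)))// => j; rewrite eq_sym.
apply: ler_sum => j _; rewrite abv.
have [bj0|bj0] := eqVneq (block_vector w ord0 j) 0.
  rewrite bj0 (orlicz_at0 p0 MO) sumr_ge0// => i _.
  by case: ifP.
have [i gi] : exists i, g (i, (w i).1) = j.
  move: bj0; rewrite mxE; case: pickP => [[i c] /eqP gj|]; last by rewrite eqxx.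
  rewrite /letter_val/=; case: ifPn => [/eqP cE _|]; last by rewrite mulr0 eqxx.
  by exists i; rewrite -cE.
rewrite (bigD1 i)//= gi eqxx; apply: (@le_trans _ _ (M a)).
  by have /andP[? ?] := bv j; exact: (orlicz_le p0 MO).
by rewrite lerDl sumr_ge0// => i' _; case: ifP.
Qed.

(* The word whose letters are, block by block, the only ones that can be
   [a / (2 q)]-close to [y]. *)
Definition nearest_word (l0 : 'I_b * 'I_q) (y : 'rV[R]_n) :
    {ffun 'I_s -> 'I_b * 'I_q} :=
  [ffun i => odflt l0 [pick l | [forall c,
     `|a * letter_val R l c - y ord0 (g (i, c))| < a / (2 * q%:R)]]].

(** If [w i] were close to [y] on the whole block, the picked letter would be close as well, and the
    triangle inequality would contradict the separation [a / q] of distinct letters. The default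
    [l0] is used only when no letter is close, in particular not [w i]. *)
Lemma nearest_word_neq l0 y w i : 0 < a -> w i != nearest_word l0 y i ->
  exists c, a / (2 * q%:R) <= `|(block_vector w - y) ord0 (g (i, c))|.
Proof.
move=> a0 wi; apply/existsP; apply: contraT; rewrite negb_exists => /forallP wnear.
have {}wnear c : `|a * letter_val R (w i) c - y ord0 (g (i, c))| < a / (2 * q%:R).
  by have := wnear c; rewrite -ltNge mxE block_vectorE mxE.
move: wi; rewrite ffunE; case: pickP => [l /forallP lnear|/(_ (w i))]; last first.
  by move/forallP; case.
move=> /letter_val_sep -/(_ R)[c].
have q0 : 0 < q%:R :> R by rewrite ltr0n (leq_trans _ (ltn_ord l0.2)).
rewrite leNgt => /negP[]; rewrite -(ltr_pM2l a0).
rewrite -[X in X * `|_|](gtr0_norm a0) -normrM mulrBr.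
rewrite -(subrKA (y ord0 (g (i, c)))) (le_lt_trans (ler_normD _ _))//.
rewrite [X in _ + X]distrC.
have -> : a / q%:R = a / (2 * q%:R) + a / (2 * q%:R).
  by field; rewrite gt_eqF.
by rewrite ltrD.
Qed.

(** Choosing one far coordinate in each differing block is injective, as blocks are disjoint. *)
Lemma card_nearest_word_neq l0 y w : 0 < a ->
  (#|[pred i | w i != nearest_word l0 y i]|
    <= #|[pred j | (a / (2 * q%:R) <= `|(block_vector w - y) ord0 j|)%R]|)%N.
Proof.
move=> a0; pose far i c := a / (2 * q%:R) <= `|(block_vector w - y) ord0 (g (i, c))|.
pose h i := g (i, odflt l0.1 [pick c | far i c]).
have h_inj : injective h by move=> i j /g_inj[].
rewrite -(fintype.card_image h_inj); apply: subset_leq_card; apply/fintype.subsetP => j.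
move=> /fintype.imageP[i wi ->]; rewrite inE /h; case: pickP => [c //|none].
by have [c] := nearest_word_neq a0 wi; rewrite -/(far i c) none.
Qed.

End block_vector.

(** * Words far from the centres of a covering *)

(** [f] assigns to each word a ball covering its block vector, and each centre is replaced by its
    nearest word; the count then yields a word far from its own centre. The result is
    [z = (x - y) / eps] for its block vector [x]. *)
Lemma cover_far_vector (R : realType) (p : R) (M1 M2 : R -> R)
    (n s b q m K : nat) (a eps : R) (y : 'I_K -> 'rV[R]_n) :
  0 < p -> orlicz_function (fun t => M1 (t `^ (1 / p))) ->
  0 < a <= 1 -> s%:R * M1 a <= 1 -> 0 < eps ->
  (0 < b)%N -> (0 < q)%N -> (s * b <= n)%N ->
  (K * (2 ^ s * (b * q) ^ m) < (b * q) ^ s)%N ->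
  (forall x, lM_norm M1 x <= 1 ->
     exists i z, lM_norm M2 z <= 1 /\ x = y i + eps *: z) ->
  exists2 z : 'rV[R]_n, lM_norm M2 z <= 1 &
    (m < #|[pred j | (a / (2 * q%:R) / eps <= `|z ord0 j|)%R]|)%N.
Proof.
move=> p0 M1O /andP[a0 a1] sMa eps0 b0 q0 sbn count cov.
have sbn' : (#|{: 'I_s * 'I_b}| <= n)%N by rewrite card_prod !card_ord.
pose g ic := widen_ord sbn' (enum_rank ic).
have g_inj : injective g 
  by move=> u v /(congr1 val)/= /val_inj/enum_rank_inj.
have a01 : 0 <= a <= 1 by rewrite ltW.
have /choice[f fP] w := cov _ (block_vector_ball (q := q) g w p0 M1O a01 sMa).
pose l0 : 'I_b * 'I_q := (Ordinal b0, Ordinal q0).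
have cardL : #|{: 'I_b * 'I_q}| = (b * q)%N by rewrite card_prod !card_ord.
have [||w far] := exists_far_word (fun i => nearest_word a g l0 (y i)) f (m := m).
- by rewrite cardL muln_gt0 b0.
- by rewrite cardL !card_ord.
have [z [z1 zE]] := fP w; exists z => //.
apply: leq_trans far _; apply: leq_trans (card_nearest_word_neq g_inj _ _ _ a0) _.
apply: subset_leq_card; apply/fintype.subsetP => j; rewrite !inE.
rewrite zE addrC addKr mxE normrM (gtr0_norm eps0) => zj.
by rewrite ler_pdivrMr// [X in _ <= X]mulrC.
Qed.

(** * Choice of the number and length of blocks *)

Lemma log2_le (R : realType) (x y : R) : 0 < x -> x <= y -> log2 x <= log2 y.
Proof.
move=> x0 xy; rewrite /log2 ler_pM2r; last by rewrite invr_gt0 ln_gt0// ltr1n.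
by rewrite ler_ln ?posrE// (lt_le_trans x0).
Qed.

Lemma log2_ge1 (R : realType) (x : R) : 2 <= x -> 1 <= log2 x.
Proof.
move=> /(log2_le (ltr0Sn _ 1)); rewrite {1}/log2 mulfV//.
by rewrite gt_eqF// ln_gt0// ltr1n.
Qed.

(** Since [n %/ s] is at least [1], rounding down costs at most a factor [2]. *)
Lemma leq_double_trunc_div (n s : nat) : (0 < s <= n)%N ->
  (n <= 2 * (s * (n %/ s)))%N.
Proof.
move=> /andP[s0 sn]; have := ltn_ceil n s0; rewrite mulSn => h.
have : (s <= n %/ s * s)%N by rewrite leq_pmull// divn_gt0.
lia.
Qed.

Lemma block_parameters (R : realType) (k n : nat)
    (t := k%:R / log2 (2 * n%:R / k%:R) : R) :
  (0 < k <= n)%N -> 1 <= t ->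
  exists s b, [/\ (0 < b)%N, (s * b <= n)%N, s%:R <= 3 * t, t / 2 <= s./2.+1%:R
    & (2 ^ k.-1 * (2 ^ s * (b * 64) ^ s./2) < (b * 64) ^ s)%N].
Proof.
have half_le (m : nat) : [/\ m./2 <= m, m <= (m - m./2) * 2 & m <= m./2.+1 * 2]%N.
  by split; lia.
move=> /andP[k0 kn] t1; have n0 : (0 < n)%N by rewrite (leq_trans k0).
have kR : 0 < k%:R :> R by rewrite ltr0n.
have nR : 0 < n%:R :> R by rewrite ltr0n.
have knR : k%:R <= n%:R :> R by rewrite ler_nat.
have ln2 : 0 < ln 2 :> R by rewrite ln_gt0// ltr1n.
pose L : R := log2 (2 * n%:R / k%:R).
have L1 : 1 <= L by rewrite log2_ge1// ler_pdivlMr// ler_pM2l.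
have L0 : 0 < L by rewrite (lt_le_trans _ L1).
have tL : t * L = k%:R by rewrite /t mulfVK// gt_eqF.
have LE : L * ln 2 = ln (2 * n%:R / k%:R) by rewrite /L /log2 mulfVK// gt_eqF.
have t0 : 0 <= t by rewrite (le_trans _ t1).
have tk : t <= k%:R by rewrite -tL ler_peMr.
have half (s : nat) : s%:R / 2 <= (s - s./2)%:R :> R.
  by rewrite ler_pdivrMr// -natrM ler_nat; have [] := half_le s.
(* Logarithmic form of the count: after cancelling [(b * 64) ^ s./2] the exponent left is at least
   [s / 2]. Strictness comes from [k.-1 < k]. *)
have count s b : (0 < b)%N ->
    (k%:R + s%:R) * ln 2 <= s%:R / 2 * ln (b * 64)%:R :> R ->
    (2 ^ k.-1 * (2 ^ s * (b * 64) ^ s./2) < (b * 64) ^ s)%N.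
  move=> b0 le.
  have Q0 : (0 < b * 64)%N by rewrite muln_gt0 b0.
  have QR : 1 <= (b * 64)%:R :> R by rewrite ler1n.
  have -> : ((b * 64) ^ s = (b * 64) ^ (s - s./2) * (b * 64) ^ s./2)%N.
    by rewrite -expnD subnK//; have [] := half_le s.
  rewrite mulnA ltn_pmul2r ?expn_gt0 ?Q0// -expnD.
  rewrite -(ltr_nat R) -ltr_ln ?posrE ?ltr0n ?expn_gt0 ?Q0//.
  rewrite !natrX !lnXn ?ltr0n// -[ln _ *+ _]mulr_natl -[X in _ < X]mulr_natl.
  apply: (@lt_le_trans _ _ ((k%:R + s%:R) * ln 2)).
    by rewrite ltr_pM2r// -natrD ltr_nat ltn_add2r prednK.
  by apply: le_trans le _; rewrite ler_wpM2r// ln_ge0.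
have /andP[c1 c2] : (Num.truncn (2 * t))%:R <= 2 * t < (Num.truncn (2 * t)).+1%:R.
  by apply: truncn_itv; rewrite mulr_ge0.
(* Thus [2 * t < s0 <= 2 * t + 1 <= 3 * t], using [t >= 1]. *)
set s0 := (Num.truncn (2 * t)).+1 in c2.
have s0t : s0%:R <= 3 * t by rewrite /s0 -natr1; lra.
have half1 (s : nat) : s%:R / 2 <= s./2.+1%:R :> R.
  by rewrite ler_pdivrMr// -natrM ler_nat; have [] := half_le s.
(* If [n <= s0], blocks of length [1] suffice: [64 = 2 ^ 6] and [k <= n] give [k + n <= 3 n]. *)
have [ns0|s0n] := leqP n s0.
  exists n, 1%N; split=> //; first by rewrite muln1.
  - by rewrite (le_trans _ s0t)// ler_nat.
  - by apply: le_trans (half1 n); lra.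
  - apply: count => //.
    have -> : (1 * 64)%:R = 2 ^+ 6 :> R by rewrite -natrX.
    by rewrite lnXn// -mulr_natl; nra.
have s00 : (0 < s0)%N by [].
exists s0, (n %/ s0)%N.
have b0 : (0 < n %/ s0)%N by rewrite divn_gt0// ltnW.
split=> //; first by rewrite mulnC leq_trunc_div.
- by apply: le_trans (half1 s0); lra.
- apply: count => //.
  (* [64 (n %/ s0) >= 32 n / s0 >= 32 n / (3 k) >= 4 (2 n / k)]. With [s0 * L >= 2 k] this gives
     [(s0 / 2) (L + 2) >= k + s0]. *)
  have lnQ : (L + 2) * ln 2 <= ln (n %/ s0 * 64)%:R :> R.
    have -> : (L + 2) * ln 2 = ln (2 * n%:R / k%:R * 2 ^+ 2) :> R.
      rewrite lnM ?posrE ?divr_gt0 ?mulr_gt0 ?exprn_gt0// lnXn// mulrDl LE.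
      by rewrite -[ln 2 *+ 2]mulr_natl.
    have Q0 : 0 < (n %/ s0 * 64)%:R :> R by rewrite ltr0n muln_gt0 b0.
    have N0 : 0 < 2 * n%:R / k%:R * 2 ^+ 2 :> R.
      by rewrite !mulr_gt0 ?invr_gt0 ?exprn_gt0.
    rewrite ler_ln ?posrE//.
    have nb : n%:R <= 2 * (s0%:R * (n %/ s0)%:R) :> R.
      by rewrite -!natrM ler_nat leq_double_trunc_div// s00 ltnW.
    have st : s0%:R <= 3 * k%:R :> R by lra.
    rewrite natrM mulrAC ler_pdivrMr//.
    have : (s0%:R - 3 * k%:R) * (n %/ s0)%:R <= 0 :> R.
      by rewrite mulr_le0_ge0// subr_le0.
    nra.
  apply: le_trans (ler_wpM2l _ lnQ); last by rewrite divr_ge0.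
  rewrite mulrA ler_pM2r// -tL.
  have : 0 <= (s0%:R - 2 * t) * L by rewrite mulr_ge0// ?subr_ge0 ltW.
  lra.
Qed.

(** * The constant *)

Lemma entropy_const_le (R : realType) (p : R) : 0 < p -> p <= 1 ->
  entropy_const p <= 3^-1 `^ (1 / p) * 2^-1 `^ (1 / p) / 256.
Proof.
move=> p0 p1; rewrite /entropy_const.
have ip1 : 1 <= 1 / p by rewrite ler_pdivlMr// mul1r.
have ip0 : 0 < 1 / p by rewrite divr_gt0.
have powN_le1 (x r : R) : 1 <= x -> 0 <= r -> x `^ (- r) <= 1.
  by move=> x1 r0; rewrite -(powRr0 x); apply: ler_powR; rewrite // oppr_le0.
have log1 : 1 <= log2 (24 / p) by rewrite log2_ge1// ler_pdivlMr//; lra.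
have f1 := powN_le1 _ (2 / p) log1 (ltW (divr_gt0 (ltr0Sn R 1) p0)).
have f2 := powN_le1 _ _ ip1 (ltW ip0).
have f3 : 2 `^ (- (19 / p)) <= 3^-1 `^ (1 / p) * 2^-1 `^ (1 / p) / 16.
  have -> : - (19 / p) = - (19%:R) * (1 / p) by rewrite mul1r mulNr.
  rewrite powRrM powR_invn//.
  apply: (@le_trans _ _ ((3^-1 * 2^-1 * 16^-1) `^ (1 / p))).
    apply: ge0_ler_powR; rewrite ?nnegrE ?(ltW ip0)//; last first.
      rewrite -!invfM lef_pV2 ?posrE//; lra.
  rewrite !powRM// ler_wpM2l ?mulr_ge0 ?powR_ge0//.
  by apply: ge1r_powR => //; lra.
have g0 := powR_ge0 (2 : R) (- (19 / p)).
have g1 := powR_ge0 (log2 (24 / p)) (- (2 / p)).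
have g2 := powR_ge0 (1 / p) (- (1 / p)).
apply: (@le_trans _ _ (4 ^- 2 * 2 `^ (- (19 / p)))).
  rewrite -mulrA ler_piMr ?mulr_ge0 ?invr_ge0 ?exprn_ge0//.
  by rewrite mulr_ile1.
have -> : 4 ^- 2 = 16^-1 :> R by congr (_^-1); ring.
lra.
Qed.

(** * The two ranges of [k] *)

Unset Implicit Arguments.

Theorem theorem3p11 (R : realType) (p : R) (M1 M2 : R -> R) (k n : nat)
  (p_gt0 : 0 < p) (p_le1 : p <= 1)
  (M1_orlicz : orlicz_function (fun t => M1 (t `^ (1 / p))))
  (M2_orlicz : orlicz_function (fun t => M2 (t `^ (1 / p))))
  (k_ge1 : (1 <= k)%N) (n_ge1 : (1 <= n)%N) :
  let e := @entropy_number R 'rV[R]_n 'rV[R]_n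
             (lM_norm M1 (n := n)) (lM_norm M2 (n := n)) idfun k in
  let t : R := k%:R / log2 (2 * n%:R / k%:R) in
  (k%:R < log2 (2 * n%:R : R) -> 2 `^ (- (1 / p)) <= e) /\
  (log2 (2 * n%:R : R) <= k%:R -> (k <= n)%N ->
     entropy_const p * (fundamental_function M2 t / fundamental_function M1 t)
       <= e).
Proof.
have ip0 : 0 < 1 / p by rewrite divr_gt0.
have ln2 : 0 < ln 2 :> R by rewrite ln_gt0// ltr1n.
have nR : 0 < n%:R :> R by rewrite ltr0n.
have kR : 0 < k%:R :> R by rewrite ltr0n.
move=> e t; split.
  move=> kn; apply: (@le_trans _ _ (2^-1)).
    rewrite powRN lef_pV2 ?posrE ?powR_gt0//.
    by apply: le1r_powR; rewrite ?ler1n// ler_pdivlMr// mul1r.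
  apply: (entropy_number_ge_half p_gt0 M1_orlicz M2_orlicz).
  (* Doubling turns [2 ^ k.-1 < n] into [2 ^ k < 2 n], which is the hypothesis on [k] after taking
     logarithms. *)
  rewrite -(@ltn_pmul2l 2)// -expnS prednK// -(ltr_nat R).
  rewrite -ltr_ln ?posrE ?ltr0n ?expn_gt0 ?muln_gt0//.
  by rewrite natrX lnXn// -[ln _ *+ _]mulr_natl natrM -ltr_pdivlMr.
move=> kn_ge kn.
have L1 : 1 <= log2 (2 * n%:R / k%:R : R).
  by rewrite log2_ge1// ler_pdivlMr// ler_pM2l// ler_nat.
have L0 : 0 < log2 (2 * n%:R / k%:R : R) by rewrite (lt_le_trans _ L1).
have t1 : 1 <= t.
  rewrite ler_pdivlMr// mul1r (le_trans _ kn_ge)// log2_le//.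
    by rewrite divr_gt0// mulr_gt0.
  by rewrite ler_pdivrMr// ler_peMr ?mulr_ge0// ler1n.
have t0 : 0 < t by rewrite (lt_le_trans _ t1).
have it01 : 0 <= t^-1 <= 1 by rewrite invr_ge0 (ltW t0) invf_le1.
(* [A] and [B] are the values of the inverses of [M1] and [M2] at [1 / t], so the ratio of
   fundamental functions is [A / B]. *)
have [A A01 MA] := orlicz_surj p_gt0 M1_orlicz it01.
have [B B01 MB] := orlicz_surj p_gt0 M2_orlicz it01.
have phi1 : fundamental_function M1 t = A^-1.
  by rewrite -(fundamental_functionE p_gt0 M1_orlicz A01) MA invrK.
have phi2 : fundamental_function M2 t = B^-1.
  by rewrite -(fundamental_functionE p_gt0 M2_orlicz B01) MB invrK.
have A0 : 0 < A.
  rewrite lt_neqAle; case/andP: (A01) => -> _; rewrite andbT; apply/eqP => A0.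
  by move: MA; rewrite -A0 (orlicz_at0 p_gt0 M1_orlicz) => /esym/eqP; rewrite invr_eq0 gt_eqF.
have B0 : 0 < B.
  rewrite lt_neqAle; case/andP: (B01) => -> _; rewrite andbT; apply/eqP => B0.
  by move: MB; rewrite -B0 (orlicz_at0 p_gt0 M2_orlicz) => /esym/eqP; rewrite invr_eq0 gt_eqF.
rewrite phi1 phi2 invrK.
have [s [b [b0 sbn st tm count]]] : exists s b, [/\ (0 < b)%N, (s * b <= n)%N,
    s%:R <= 3 * t, t / 2 <= s./2.+1%:R
    & (2 ^ k.-1 * (2 ^ s * (b * 64) ^ s./2) < (b * 64) ^ s)%N].
  by apply: block_parameters t1; rewrite k_ge1.
(* The factor compensates [s <= 3 * t]: [M1 a <= M1 A / 3 = 1 / (3 t)]. *)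
pose a := 3^-1 `^ (1 / p) * A.
have i3 : 0 <= (3^-1 : R) <= 1 by lra.
have i2 : 0 <= (2^-1 : R) <= 1 by lra.
have /andP[r30 r31] := powR_itv01 ip0 i3.
have /andP[r20 r21] := powR_itv01 ip0 i2.
have r3 : 0 < 3^-1 `^ (1 / p) :> R by rewrite powR_gt0// invr_gt0.
have /andP[_ A1] := A01; have /andP[_ B1] := B01.
have a01 : 0 < a <= 1 by rewrite mulr_gt0//= mulr_ile1// ltW.
have sMa : s%:R * M1 a <= 1.
  have := orlicz_scale p_gt0 M1_orlicz i3 A01; rewrite -/a MA => Ma.
  apply: (@le_trans _ _ (3 * t * (3^-1 * t^-1))); last first.
    by rewrite mulrACA !mulfV ?mulr1// gt_eqF.
  by apply: ler_pM => //; apply: (orlicz_ge0 p_gt0 M1_orlicz); case/andP: a01 => // /ltW.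
apply: (entropy_number_ge p_gt0 M1_orlicz M2_orlicz) => eps y eps0 cov.
have [z z1 far] :=
  cover_far_vector p_gt0 M1_orlicz a01 sMa eps0 b0 (isT : 0 < 64)%N sbn count cov.
set beta := a / (2 * 64%:R) / eps in far.
have /andP[a0 a1] := a01.
have beta0 : 0 < beta by rewrite !divr_gt0// mulr_gt0.
(* [z] has a coordinate of modulus at least [beta], and coordinates in the unit ball are at most
   [1]; this keeps the arguments of [M2] inside [[0, 1]]. *)
have beta1 : beta <= 1.
  have /card_gt0P[j] := leq_trans (ltn0Sn _) far; rewrite inE => /le_trans; apply.
  exact: (unit_ball_coord j p_gt0 M2_orlicz z1).
have b01 : 0 <= beta <= 1 by rewrite ltW.
have := unit_ball_card_large p_gt0 M2_orlicz z1 b01 far => Mb.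
have hb01 : 0 <= beta / 2 <= 1 by lra.
have Mb2 : M2 (2^-1 `^ (1 / p) * (beta / 2)) <= t^-1.
  apply: (le_trans (orlicz_scale p_gt0 M2_orlicz i2 hb01)).
  rewrite -[t^-1]mul1r ler_pdivlMr//; apply: le_trans Mb.
  rewrite mulrAC mulrC [X in X <= _]mulrC ler_wpM2r//; last by lra.
  by case/andP: hb01 => *; exact: (orlicz_ge0 p_gt0 M2_orlicz).
have betaB : 2^-1 `^ (1 / p) * (beta / 2) <= B.
  rewrite leNgt; apply/negP => lt.
  have := orlicz_lt p_gt0 M2_orlicz (ltW B0) lt; rewrite MB ltNge Mb2.
  by case/andP: hb01 => h0 h1 /(_ (mulr_ile1 r20 h0 r21 h1)).
apply: (@le_trans _ _ (3^-1 `^ (1 / p) * 2^-1 `^ (1 / p) / 256 * (B^-1 * A))).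
  rewrite ler_wpM2r ?entropy_const_le// mulr_ge0 ?invr_ge0 ?(ltW A0) ?(ltW B0)//.
(* Here [256 = 2 * (2 * 64)]: the [2] from [beta / 2] and the rest from [beta = a / 128 / eps]. *)
have -> : 3^-1 `^ (1 / p) * 2^-1 `^ (1 / p) / 256 * (B^-1 * A) =
    2^-1 `^ (1 / p) * (beta / 2) * eps / B.
  by rewrite /beta /a; field; rewrite !gt_eqF.
by rewrite ler_pdivrMr// mulrC ler_pM2l.
Qed.
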